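(* Let $\theta\in[0,1]$. Let $(v_k)$ and $(\tilde v_k)$ be two sequences in $\mathbb{R}^{N_xN_y}$ generated with the same time steps $\tau_k$ by the scheme $$v_{k+1}=\Phi_k v_k+M^{-1}[\Phi_k-I]\,[\theta g(\varepsilon,v_k)+(1-\theta)g(\varepsilon,v_{k+1})],\qquad k\ge0,$$ starting from $v_0$ and from a perturbed initial vector $\tilde v_0$, respectively (whenever $g$ is evaluated, its argument has all components in $[0,1)$). Let $z_k=v_k-\tilde v_k$. Let $t_Q$ be the time at which numerical quenching occurs, i.e. the first time level at which $\|v_Q\|_\infty\ge1$. Then, for $\tau_k\ge0$ sufficiently small, the method is unconditionally stable in the von Neumann sense: for every time level $t_m<t_Q$ there exists a constant $C(t_m)>0$, independent of $k$ and of $\tau_j$ for each $0\le j\le k$, such that $$\|z_{k+1}\|_2\le C(t_m)\|z_0\|_2,\qquad 0\le k\le m .$$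
   Context: Mesh: $\mathcal{D}=(-1,1)\times(-1,1)$, $a,b>0$, $N_x,N_y$ are (large) positive integers, $-1=x_0<x_1<\dots<x_{N_x+1}=1$, $-1=y_0<\dots<y_{N_y+1}=1$, $h_{x,i}=x_{i+1}-x_i>0$ ($0\le i\le N_x$), $h_{y,j}=y_{j+1}-y_j>0$ ($0\le j\le N_y$); the mesh is otherwise arbitrary. The degeneracy function $\sigma:\overline{\mathcal{D}}\to[0,\infty)$ vanishes only on a subset of $\partial\mathcal{D}$; $\sigma_{i,j}=\sigma(x_i,y_j)$. Interior grid vectors $v=(v_{1,1},v_{2,1},\dots,v_{N_x,1},v_{1,2},\dots,v_{N_x,N_y})^{T}\in\mathbb{R}^{N_xN_y}$ are ordered lexicographically. Time levels are $t_k=t_0+\sum_{j=0}^{k-1}\tau_j$, and all times considered lie in a bounded interval $[t_0,T_q]$ with $T_q<\infty$. Matrices: $B=\mathrm{diag}(\sigma_{1,1}^{-1},\sigma_{2,1}^{-1},\dots,\sigma_{N_x,N_y}^{-1})$ (same ordering); for $\alpha\in\{x,y\}$, $T_\alpha\in\mathbb{R}^{N_\alpha\times N_\alpha}$ is tridiagonal with $(T_\alpha)_{i,i}=-\frac{2}{h_{\alpha,i-1}h_{\alpha,i}}$, $(T_\alpha)_{i,i+1}=\frac{2}{h_{\alpha,i}(h_{\alpha,i-1}+h_{\alpha,i})}$, $(T_\alpha)_{i+1,i}=\frac{2}{h_{\alpha,i}(h_{\alpha,i}+h_{\alpha,i+1})}$; $M_x=a^{-2}B(I_{N_y}\otimes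 T_x)$, $M_y=b^{-2}B(T_y\otimes I_{N_x})$, $M=M_x+M_y$. With time steps $\tau_k$ and $E(A)=e^{A}$ the matrix exponential, $\Phi_{x,k}=E(\tau_kM_x/2)$, $\Phi_{y,k}=E(\tau_kM_y)$, $\Phi_k=\Phi_{x,k}\Phi_{y,k}\Phi_{x,k}$. Reaction term: $\varepsilon=\varepsilon(x,y)$ is a bounded stochastic influence (fixed in time). For each value of $\varepsilon$, $f(\varepsilon,\cdot)$ is a continuously differentiable function on $[0,1)$ with $f(\varepsilon,0)>0$, $f_u(\varepsilon,u)>0$, $\lim_{u\to1^-}f(\varepsilon,u)=\infty$, $\int_0^1 f(\varepsilon,u)\,du=\infty$, and for each $u\in[0,1)$ the values $f(\varepsilon,u)$ are bounded above and bounded below by a positive constant as $\varepsilon$ varies. For $v\in[0,1)^{N_xN_y}$, $g(\varepsilon,v)$ is the vector with components $f(\varepsilon(x_i,y_j),v_{i,j})/\sigma_{i,j}$.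
   Formalization: Arguments of g are required to lie in [0,κ] for an arbitrary fixed κ<1, instead of [0,1); the smallness of τ_k and C(t_m) may depend on κ. Otherwise, for θ<1, the implicit step can have two solutions in [0,1), so z_0=0 but z_1≠0. *)

(* Defs.v *)
From mathcomp Require Import all_boot all_order all_algebra.
From mathcomp Require Import all_classical all_reals all_analysis.
From mathcomp Require Export mxtens.
Set Implicit Arguments.
Unset Strict Implicit.
Unset Printing Implicit Defensive.
Import Order.TTheory GRing.Theory Num.Theory.
Import numFieldNormedType.Exports.
Local Open Scope classical_set_scope.
Local Open Scope ring_scope.

Section Defs.
Variable R : realType.

Definition square : set (R * R) := `]-1, 1[%classic `*` `]-1, 1[%classic.

(* Only the nodes s 0, ..., s N.+1 are meaningful. *)
Definition is_mesh (N : nat) (s : nat -> R) : Prop :=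
  [/\ s 0%N = -1, s N.+1 = 1 & forall i, (i <= N)%N -> s i < s i.+1].

Definition mesh_step (s : nat -> R) (i : nat) : R := s i.+1 - s i.

(* The index i : 'I_N stands for the interior node i.+1, so that the
   coefficients below are the usual ones with h shifted by one. *)
Definition second_diff (N : nat) (s : nat -> R) : 'M[R]_N :=
  let h := mesh_step s in
  \matrix_(i < N, j < N)
    if j == i :> nat then - (2 / (h i * h i.+1))
    else if j == i.+1 :> nat then 2 / (h i.+1 * (h i + h i.+1))
    else if i == j.+1 :> nat then 2 / (h j.+1 * (h j.+1 + h j.+2))
    else 0.

(* mxtens_unindex p = (j, i) where p = j * Nx + i, which is the lexicographic
   ordering with the x-index running fastest. *)
Definition grid_values (Nx Ny : nat) (x y : nat -> R) (s : R -> R -> R) :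
    'cV[R]_(Ny * Nx) :=
  \col_p s (x (mxtens_unindex p).2.+1) (y (mxtens_unindex p).1.+1).

Definition expmx (n : nat) (A : 'M[R]_n) : 'M[R]_n :=
  limn (series (fun k => (k`!%:R)^-1 *: A ^+ k)).

Definition norm2 (n : nat) (v : 'cV[R]_n) : R := Num.sqrt (\sum_i v i 0 ^+ 2).

Section Scheme.
Variables (a b : R) (Nx Ny : nat) (x y : nat -> R) (sigma : R -> R -> R).

Definition Bmx : 'M[R]_(Ny * Nx) :=
  diag_mx (\row_p (grid_values Nx Ny x y sigma p 0)^-1).

Definition Mx : 'M[R]_(Ny * Nx) :=
  a ^- 2 *: (Bmx *m ((1%:M : 'M[R]_Ny) *t second_diff Nx x)).

Definition My : 'M[R]_(Ny * Nx) :=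
  b ^- 2 *: (Bmx *m (second_diff Ny y *t (1%:M : 'M[R]_Nx))).

Definition Mxy : 'M[R]_(Ny * Nx) := Mx + My.

Definition Phi (tau : R) : 'M[R]_(Ny * Nx) :=
  expmx ((tau / 2) *: Mx) *m expmx (tau *: My) *m expmx ((tau / 2) *: Mx).

Definition reaction (f : R -> R -> R) (eps : R -> R -> R)
    (v : 'cV[R]_(Ny * Nx)) : 'cV[R]_(Ny * Nx) :=
  \col_p (f (grid_values Nx Ny x y eps p 0) (v p 0) /
          grid_values Nx Ny x y sigma p 0).

Definition scheme_step (f : R -> R -> R) (eps : R -> R -> R) (theta tau : R)
    (v w : 'cV[R]_(Ny * Nx)) : Prop :=
  w = Phi tau *m v + invmx Mxy *m (Phi tau - 1%:M) *m
        (theta *: reaction f eps v + (1 - theta) *: reaction f eps w).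

End Scheme.

Definition time_level (t0 : R) (tau : nat -> R) (k : nat) : R :=
  t0 + \sum_(j < k) tau j.

(* The norm of the normedModType of matrices is the maximum norm. *)
Definition quenches_at (n : nat) (v : nat -> 'cV[R]_n) (Q : nat) : Prop :=
  1 <= `|v Q| /\ forall k, (k < Q)%N -> `|v k| < 1.

(* t < t_Q, where t_Q = +oo if v never quenches. *)
Definition before_quenching (t0 : R) (tau : nat -> R) (n : nat)
    (v : nat -> 'cV[R]_n) (t : R) : Prop :=
  forall Q, quenches_at v Q -> t < time_level t0 tau Q.

(* The vectors at which the reaction term is evaluated in steps 0, ..., m have
   all their components in A.  A term with coefficient theta = 0 or
   1 - theta = 0 is not evaluated; in particular the explicit scheme does not
   evaluate it at v m.+1, which may already have quenched.
   A run that has not quenched satisfies this with A = [0, kappa] for some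
   kappa < 1.  The derivative of the reaction term is unbounded near 1, so
   stability constants can only be uniform in the step sizes for fixed kappa. *)
Definition reaction_args_in (A : set R) (theta : R) (n : nat)
    (v : nat -> 'cV[R]_n) (m : nat) : Prop :=
  forall k, (k <= m)%N ->
    (theta != 0 -> forall p, A (v k p 0)) /\
    (theta != 1 -> forall p, A (v k.+1 p 0)).

(* fu is the derivative of f within [0, 1[ (one-sided at 0), and it is
   continuous on [0, 1[. *)
Definition is_C1_with_derivative (f fu : R -> R) : Prop :=
  (forall u, 0 <= u < 1 ->
     (f w - f u) / (w - u) @[w --> within `[0, 1[%classic u^'] --> fu u) /\
  {within `[0, 1[%classic, continuous fu}.

(* V is the set of values taken by the stochastic influence. *)
Definition is_reaction_function (V : set R) (f fu : R -> R -> R) : Prop :=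
  (forall e, V e ->
     [/\ is_C1_with_derivative (f e) (fu e),
         0 < f e 0,
         forall u, 0 <= u < 1 -> 0 < fu e u,
         f e u @[u --> 1^'-] --> +oo &
         (\int[lebesgue_measure]_(u in `[0%R, 1%R[) (f e u)%:E = +oo)%E]) /\
  (forall u, 0 <= u < 1 ->
     exists lo hi, 0 < lo /\ forall e, V e -> lo <= f e u <= hi).

End Defs.

(* Main.v *)
Require Import Defs.
From HB Require Import structures.
From mathcomp Require Import all_boot all_order all_algebra.
From mathcomp Require Import all_classical all_reals all_analysis.
From mathcomp Require Import ring lra.
Set Implicit Arguments.
Unset Strict Implicit.
Unset Printing Implicit Defensive.
Import Order.TTheory GRing.Theory Num.Theory.
Import numFieldNormedType.Exports.
Local Open Scope classical_set_scope.
Local Open Scope ring_scope.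

(** The grid is fixed, so stability is a Gronwall estimate in finite dimension;
all constants may depend on the mesh, on [f], on [kappa] and on the time
horizon, but not on the time steps.

Each factor of [Phi tau] is the exponential of a multiple of [tau], hence
[Phi tau] differs from the identity by O(tau) for [tau] in [0, 1]
([near_id_Phi]).  The components of the two solutions at which the reaction term
is evaluated stay in [0, kappa] with [kappa < 1].  There [fu] is bounded, being
continuous on a compact interval, so by the mean value theorem the reaction term
is Lipschitz ([reaction_lipschitz]).  Subtracting the two runs of the scheme,
the differences [z k] satisfy
  |z (k+1)| <= (1 + O(tau k)) |z k| + O(tau k) (|z k| + |z (k+1)|),
where the matrix in front of [Phi - 1] only contributes its norm
([mxnorm_step]).  Once the time steps are small, the implicit term is absorbed in
the left-hand side, which gives |z (k+1)| <= exp (ga * tau k) |z k|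
([implicit_growth]).  The product of these factors is the exponential of [ga]
times the elapsed time, at most [ga * (Tq - t0)] ([expR_gronwall]).  The estimates
are made in the maximum norm, which is equivalent to the Euclidean one. *)

(** * Maximum norm of matrices *)

(** Matrices are known to be complete and to be normed; the instance joins the two
structures, so that normally convergent series of matrices converge. *)
HB.instance Definition _ (R : realType) (m n : nat) := Complete.on 'M[R]_(m, n).

Section MatrixNorm.
Variable R : realType.

Lemma coord_le_mxnorm m n (M : 'M[R]_(m, n)) i j : `|M i j| <= `|M|.
Proof.
rewrite [leRHS]/Num.norm /= mx_normrE.
by apply: (le_bigmax _ (fun ij : 'I_m * 'I_n => `|M ij.1 ij.2|) (i, j)).
Qed.

Lemma mxnorm_le m n (M : 'M[R]_(m, n)) (c : R) :
  0 <= c -> (forall i j, `|M i j| <= c) -> `|M| <= c.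
Proof.
by move=> c0 Mc; rewrite [leLHS]/Num.norm /= mx_normrE; apply: bigmax_le => // -[].
Qed.

(** The maximum norm is submultiplicative only up to the inner dimension, as
the product of two matrices with all entries 1 shows; hence the factors [n%:R]. *)
Lemma mxnormM m n p (A : 'M[R]_(m, n)) (B : 'M[R]_(n, p)) :
  `|A *m B| <= n%:R * `|A| * `|B|.
Proof.
apply: mxnorm_le => [|i j]; first by rewrite !mulr_ge0.
rewrite mxE (le_trans (ler_norm_sum _ _ _))// -mulrA.
rewrite [leRHS](_ : _ = \sum_(k < n) `|A| * `|B|); last first.
  by rewrite sumr_const card_ord mulr_natl.
by apply: ler_sum => k _; rewrite normrM ler_pM ?coord_le_mxnorm.
Qed.

Lemma mxnormX n (A : 'M[R]_n) k : `|A ^+ k| <= (n%:R * `|A|) ^+ k.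
Proof.
elim: k => [|k IH].
  rewrite !expr0; apply: mxnorm_le => // i j.
  by rewrite mxE; case: eqP; rewrite ?normr1 ?normr0.
rewrite !exprS (le_trans (mxnormM _ _))// ler_wpM2l ?mulr_ge0//.
Qed.

Lemma norm2_ge_mxnorm n (v : 'cV[R]_n) : `|v| <= norm2 v.
Proof.
apply: mxnorm_le => [|i j]; first exact: sqrtr_ge0.
rewrite ord1 -sqrtr_sqr ler_wsqrtr// (bigD1 i)//= lerDl.
by rewrite sumr_ge0// => k _; rewrite sqr_ge0.
Qed.

Lemma norm2_le_mxnorm n (v : 'cV[R]_n) : norm2 v <= Num.sqrt n%:R * `|v|.
Proof.
rewrite -[X in _ * X]ger0_norm// -sqrtr_sqr -sqrtrM// ler_wsqrtr//.
rewrite [leRHS](_ : _ = \sum_(k < n) `|v| ^+ 2); last first.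
  by rewrite sumr_const card_ord mulr_natl.
apply: ler_sum => k _; rewrite -[leLHS]ger0_norm ?sqr_ge0// normrX.
by rewrite lerXn2r ?nnegrE// coord_le_mxnorm.
Qed.

End MatrixNorm.

(** * The matrix exponential near the identity *)

Section Exponential.
Variable R : realType.

Lemma is_cvg_expmx n (A : 'M[R]_n) :
  cvgn (series (fun k => (k`!%:R)^-1 *: A ^+ k)).
Proof.
apply: normed_cvg; apply: series_le_cvg (is_cvg_series_exp_coeff (n%:R * `|A|)).
- by move=> k /=.
- by move=> k; rewrite exp_coeff_ge0// mulr_ge0.
move=> k /=; rewrite normrZ ger0_norm ?invr_ge0// exp_coeffE.
by rewrite ler_wpM2l ?invr_ge0// mxnormX.
Qed.

(** Without its constant term, the exponential series of [A] is dominated term by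
term by that of the real number [n%:R * `|A|]. *)
Lemma norm_expmx_sub1 n (A : 'M[R]_n) :
  `|expmx A - 1%:M| <= expR (n%:R * `|A|) - 1.
Proof.
have cv := @is_cvg_expmx n A.
have cv1 : (series (fun k => (k`!%:R)^-1 *: A ^+ k) m - 1%:M) @[m --> \oo] -->
   expmx A - 1%:M by apply: cvgB => //; exact: cvg_cst.
rewrite -(cvg_lim (@norm_hausdorff _ _) cv1) -lim_norm; last first.
  by apply/cvg_ex; eexists; exact: cv1.
apply: limr_le; first by apply: is_cvg_norm; apply/cvg_ex; eexists; exact: cv1.
near=> m.
(* the constant term can be split off once the partial sum is nonempty *)
have [p ->] : exists p, m = p.+1.
  by exists m.-1; rewrite prednK//; near: m; exists 1%N.
rewrite /series /= big_nat_recl//= fact0 invr1 scale1r expr0 addrC addKr.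
rewrite (le_trans (ler_norm_sum _ _ _))// lerBrDl.
apply: le_trans (nondecreasing_cvgn_le _ (is_cvg_series_exp_coeff (n%:R * `|A|)) p.+1).
  rewrite /series /= big_nat_recl//= exp_coeffE fact0 invr1 expr0 mulr1 lerD2l.
  apply: ler_sum => k _; rewrite normrZ ger0_norm ?invr_ge0//.
  by rewrite ler_wpM2l ?invr_ge0// mxnormX.
apply: nondecreasing_series => k _ _; rewrite exp_coeff_ge0// mulr_ge0//.
Unshelve. all: by end_near. Qed.

(** [F t = 1 + O(t)], uniformly on the unit interval. *)
Definition near_id n (F : R -> 'M[R]_n) :=
  exists2 c : R, 0 <= c & forall t, 0 <= t <= 1 -> `|F t - 1%:M| <= c * t.

Lemma near_id_expmx n (A : 'M[R]_n) : near_id (fun t => expmx (t *: A)).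
Proof.
set b := n%:R * `|A|; have b0 : 0 <= b by rewrite mulr_ge0.
exists (b * expR b) => [|t /andP[t0 t1]]; first by rewrite mulr_ge0// expR_ge0.
apply: le_trans (norm_expmx_sub1 _) _; rewrite normrZ ger0_norm// mulrCA -/b.
(* e^s - 1 <= s e^s is the inequality 1 - s <= e^-s multiplied by e^s *)
have e1 : 1 - t * b <= expR (- (t * b)) by rewrite -[leLHS]/(1 + - _) expR_ge1Dx.
have e2 : expR (t * b) - 1 <= t * b * expR (t * b).
  have := ler_wpM2r (expR_ge0 (t * b)) e1.
  rewrite mulrBl mul1r -expRD addNr expR0; lra.
apply: le_trans e2 _; clearbody b; rewrite -!mulrA mulrCA ler_wpM2l// [leLHS]mulrC.
by rewrite ler_wpM2r// ler_expR ler_piMl.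
Qed.

(** With [F = 1 + D] and [G = 1 + E], the product minus [1] is [D E + D + E], and
the quadratic term is O(t) since [t <= 1]. *)
Lemma near_id_mul n (F G : R -> 'M[R]_n) :
  near_id F -> near_id G -> near_id (fun t => F t *m G t).
Proof.
move=> [c c0 Fc] [c' c'0 Gc]; exists (n%:R * c * c' + c + c').
  by rewrite !addr_ge0// !mulr_ge0.
move=> t t01; move: (Fc t t01) (Gc t t01); case/andP: t01 => t0 t1.
set D := F t - 1%:M; set E := G t - 1%:M => hD hE.
have -> : F t *m G t - 1%:M = D *m E + D + E.
  rewrite -[X in _ *m E + X]mulmx1 -mulmxDr subrK.
  by rewrite /D /E mulmxBl mul1mx addrA subrK.
have hDE : `|D *m E| <= n%:R * c * c' * t.
  apply: le_trans (mxnormM _ _) _.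
  apply: (@le_trans _ _ (n%:R * (c * t) * (c' * t))).
    by rewrite ler_pM ?mulr_ge0// ler_wpM2l.
  rewrite [leLHS](_ : _ = n%:R * c * c' * t * t); last by ring.
  by rewrite ler_piMr// !mulr_ge0.
rewrite (le_trans (ler_normD _ _))// (mulrDl _ c') lerD//.
by rewrite (le_trans (ler_normD _ _))// (mulrDl _ c) lerD.
Qed.

Lemma near_id_Phi (a b : R) (Nx Ny : nat) (x y : nat -> R) (sigma : R -> R -> R) :
  near_id (@Phi R a b Nx Ny x y sigma).
Proof.
have half (A : 'M[R]_(Ny * Nx)) : near_id (fun t => expmx ((t / 2) *: A)).
  have [c c0 Ac] := near_id_expmx (2^-1 *: A).
  by exists c => // t /Ac; rewrite scalerA.
exact: near_id_mul (near_id_mul (half _) (near_id_expmx _)) (half _).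
Qed.

End Exponential.

(** * Lipschitz continuity of C1 functions on compact subintervals *)

Section Lipschitz.
Variable R : realType.
Implicit Types f fu : R -> R.

(** At an interior point the restriction to [0, 1[ is immaterial, so the one-sided
notion of derivative is the usual one; only the difference quotients have to be
reparametrized, from [z] to [h = z - u]. *)
Lemma C1_is_derive f fu (u : R) : is_C1_with_derivative f fu -> 0 < u < 1 ->
  is_derive u 1 f (fu u).
Proof.
move=> [df _] /andP[u0 u1].
have u01 : 0 <= u < 1 by rewrite ltW.
have lim : h^-1 *: (f (h *: 1 + u) - f u) @[h --> 0^'] --> fu u.
  apply/cvgrPdist_lt => e e0.
  have [r r0 rP] : exists2 r, 0 < r & forall z, `|u - z| < r -> z != u ->
      0 <= z < 1 -> `|fu u - (f z - f u) / (z - u)| < e.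
    have /cvgrPdist_lt/(_ e e0)/nbhs_ballP[r /= r0 rP] := df u u01.
    by exists r => // z zr zu z01; apply: (rP z zr zu); rewrite /= in_itv.
  near=> h.
  have h0 : h != 0 by near: h; exact: nbhs_dnbhs_neq.
  (* keeps h + u in the ball where the quotient is close to fu u, and in ]0, 1[ *)
  have hr : `|h| < Num.min r (Num.min u (1 - u)).
    near: h; apply: dnbhs0_lt; rewrite !lt_min r0 u0/=; lra.
  move: hr; rewrite !lt_min => /and3P[hr hu hu1].
  rewrite -[h *: 1]/(h * 1) mulr1 -[_ *: _]/(_ * _) mulrC.
  rewrite -[X in _ / X](addrK u); apply: rP.
  - by rewrite opprD addrCA subrr addr0 normrN.
  - by rewrite -subr_eq0 addrK.
  - by move: hu hu1; rewrite !ltr_norml; lra.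
have dv : derivable f u 1 by apply/cvg_ex; exists (fu u).
apply: DeriveDef dv _; exact: cvg_lim lim.
Unshelve. all: by end_near. Qed.

(** [f z - f u] is the difference quotient, which has a finite limit, times
[z - u], which tends to 0. *)
Lemma C1_continuous f fu : is_C1_with_derivative f fu ->
  {within `[0, 1[, continuous f}.
Proof.
move=> [df _]; apply/subspace_continuousP => u; rewrite /= in_itv /= => u01.
have lim : f x @[x --> within `[0, 1[ u^'] --> f u.
  have lim1 : (f x - f u) / (x - u) * (x - u) + f u @[x --> within `[0, 1[ u^'] -->
      fu u * (u - u) + f u.
    apply: cvgD; last exact: cvg_cst.
    apply: cvgM; first exact: df.
    apply: cvg_within_filter; apply: cvg_within_filter.
    by apply: cvgB; [exact: cvg_id|exact: cvg_cst].
  rewrite subrr mulr0 add0r in lim1.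
  apply: cvg_trans lim1; apply: near_eq_cvg.
  have : \forall z \near within `[0, 1[ u^', z != u.
    exact: cvg_within (@nbhs_dnbhs_neq R u).
  by apply: filterS => z zu; rewrite divfK ?subrK// subr_eq0.
apply/cvgrPdist_lt => e e0.
have [r r0 rP] : exists2 r, 0 < r & forall z, `|u - z| < r -> z != u ->
    0 <= z < 1 -> `|f u - f z| < e.
  have /cvgrPdist_lt/(_ e e0)/nbhs_ballP[r /= r0 rP] := lim.
  by exists r => // z zr zu z01; apply: (rP z zr zu); rewrite /= in_itv.
apply/nbhs_ballP; exists r => //= z zr z01.
have [->|zu] := eqVneq z u; first by rewrite subrr normr0.
by apply: rP => //; rewrite /= in_itv in z01.
Qed.

(** [fu] is bounded on the compact interval [0, kappa]; the mean value theorem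
turns its bound into a Lipschitz constant. *)
Lemma C1_lipschitz f fu (kappa : R) : is_C1_with_derivative f fu -> kappa < 1 ->
  exists2 L, 0 <= L & forall u v, 0 <= u <= kappa -> 0 <= v <= kappa ->
    `|f u - f v| <= L * `|u - v|.
Proof.
move=> fC1 k1; have fc := C1_continuous fC1; have [_ fuc] := fC1.
have sub (p q : R) : 0 <= p -> q <= kappa -> `[p, q] `<=` `[0, 1[.
  move=> p0 qk z /=; rewrite !in_itv /=; lra.
have /compact_bounded[L0 [_ L0P]] : compact [set fu x | x in `[0, kappa]].
  apply: continuous_compact; last exact: segment_compact.
  exact: continuous_subspaceW (sub 0 kappa _ _) fuc.
(* compact_bounded provides a bound only above L0, hence L0 + 1 *)
have L0L : L0 < Num.max (L0 + 1) 0 by rewrite lt_max; apply/orP; left; lra.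
exists (Num.max (L0 + 1) 0); first by rewrite le_max lexx orbT.
suff lip u v : 0 <= u -> u <= v -> v <= kappa ->
    `|f v - f u| <= Num.max (L0 + 1) 0 * `|v - u|.
  move=> u v /andP[u0 uk] /andP[v0 vk]; case: (leP u v) => uv.
    by rewrite distrC (distrC u) lip.
  by rewrite lip// ltW.
move=> u0 uv vk.
have dfu z : z \in `]u, v[ -> is_derive z 1 f (fu z).
  by rewrite in_itv /= => /andP[uz zv]; apply: C1_is_derive fC1 _; lra.
have [c] := MVT_segment uv dfu (continuous_subspaceW (sub u v u0 vk) fc).
rewrite in_itv /= => /andP[uc cv] ->; rewrite normrM ler_wpM2r//.
apply: L0P L0L _ _; exists c => //=; rewrite in_itv /=; lra.
Qed.

End Lipschitz.

(** * The reaction term on the grid *)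

Section Reaction.
Variable R : realType.

Lemma mesh_lt N (s : nat -> R) i j :
  is_mesh N s -> (i < j <= N.+1)%N -> s i < s j.
Proof.
move=> [_ _ s_incr] /andP[]; elim: j => // j IH ij jN.
apply: le_lt_trans (s_incr j _) => //.
by move: ij; rewrite ltnS leq_eqVlt => /predU1P[->//|ij]; rewrite ltW// IH// ltnW.
Qed.

Lemma mesh_interior N (s : nat -> R) (i : 'I_N) :
  is_mesh N s -> s i.+1 \in `]-1, 1[.
Proof.
move=> ms; have [<- <- _] := ms.
rewrite in_itv /=; apply/andP; split; apply: (mesh_lt ms) => //=.
  by rewrite ltnS ltnW.
by rewrite ltnS ltn_ord leqnn.
Qed.

(** The reaction term acts component by component.  Each grid point has its own
Lipschitz constant, as the stochastic influence and the degeneracy vary with the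
point; their sum over the grid bounds them all. *)
Lemma reaction_lipschitz Nx Ny (x y : nat -> R) (sigma f fu eps : R -> R -> R)
    (kappa : R) :
  (forall p : 'I_(Ny * Nx), let e := grid_values Nx Ny x y eps p 0 in
     is_C1_with_derivative (f e) (fu e)) ->
  kappa < 1 ->
  exists2 L, 0 <= L & forall v v' : 'cV[R]_(Ny * Nx),
    (forall p, v p 0 \in `[0, kappa]) -> (forall p, v' p 0 \in `[0, kappa]) ->
    `|reaction x y sigma f eps v - reaction x y sigma f eps v'| <= L * `|v - v'|.
Proof.
move=> fC1 k1.
have /choice[l lP] : forall p, exists l, 0 <= l /\ forall u v, 0 <= u <= kappa ->
    0 <= v <= kappa ->
    let e := grid_values Nx Ny x y eps p 0 in `|f e u - f e v| <= l * `|u - v|.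
  by move=> p; have [l] := C1_lipschitz (fC1 p) k1; exists l.
pose s p := grid_values Nx Ny x y sigma p 0.
have l0 p : 0 <= l p by have [] := lP p.
exists (\sum_p l p * `|(s p)^-1|) => [|v v' vk v'k].
  by rewrite sumr_ge0// => p _; rewrite mulr_ge0.
apply: mxnorm_le => [|p j].
  by rewrite mulr_ge0// sumr_ge0// => p _; rewrite mulr_ge0.
rewrite ord1 !mxE -mulrBl normrM.
have [_ /(_ (v p 0) (v' p 0)) fl] := lP p.
apply: (@le_trans _ _ (l p * `|(s p)^-1| * `|v - v'|)).
  rewrite mulrAC /s mxE ler_wpM2r//.
  have := fl (vk p) (v'k p); rewrite /= [grid_values _ _ _ _ _ p 0]mxE.
  move=> /le_trans; apply.
  by rewrite ler_wpM2l// (le_trans _ (coord_le_mxnorm _ p 0))// !mxE.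
rewrite ler_wpM2r// (bigD1 p)//= lerDl sumr_ge0// => q _.
by rewrite mulr_ge0.
Qed.

End Reaction.

(** * Growth of the error *)

Section ErrorGrowth.
Variable R : realType.

(** One step of the scheme for the difference [z] of two runs: [h] is the weighted
difference of the reaction terms at the old and at the new time level, and [N]
stands for the inverse of the discrete operator. *)
Lemma mxnorm_step n (F N : 'M[R]_n) (z z' h : 'cV[R]_n) (c t L : R) :
  0 <= c -> 0 <= t -> 0 <= L -> `|F - 1%:M| <= c * t ->
  `|h| <= L * (`|z| + `|z'|) -> z' = F *m z + N *m (F - 1%:M) *m h ->
  `|z'| <= (1 + n%:R * c * t) * `|z|
           + n%:R * n%:R * `|N| * c * L * t * (`|z| + `|z'|).
Proof.
move=> c0 t0 L0 F1 hL z'E; rewrite {1}z'E.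
apply: le_trans (ler_normD _ _) _; apply: lerD.
  rewrite -[F](subrK 1%:M) mulmxDl mul1mx (le_trans (ler_normD _ _))//.
  rewrite mulrDl mul1r addrC lerD2l (le_trans (mxnormM _ _))//.
  by rewrite ler_wpM2r// -mulrA ler_wpM2l.
apply: le_trans (mxnormM _ _) _.
rewrite [leRHS](_ : _ =
  n%:R * (n%:R * `|N| * (c * t)) * (L * (`|z| + `|z'|))); last by ring.
rewrite ler_pM ?mulr_ge0// ler_wpM2l// (le_trans (mxnormM _ _))//.
by rewrite ler_wpM2l// mulr_ge0.
Qed.

Lemma small_step (be t : R) :
  0 <= be -> 0 <= t -> t <= (1 + 2 * be)^-1 -> t <= 1 /\ be * t <= 2^-1.
Proof.
move=> be0 t0; have bt0 := mulr_ge0 be0 t0.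
by rewrite -div1r ler_pdivlMr; [split|]; lra.
Qed.

(** Absorbing the implicit term leaves the factor [(1 + A + B) / (1 - B)] with
[A = al * t] and [B = be * t <= 1/2].  It is at most [1 + 2 A + 4 B], because
[(1 - B) (1 + 2 A + 4 B) - (1 + A + B) = (1/2 - B) (2 A + 4 B)]. *)
Lemma implicit_growth (al be t r r' : R) :
  0 <= al -> 0 <= be -> 0 <= t -> be * t <= 2^-1 -> 0 <= r ->
  r' <= (1 + al * t) * r + be * t * (r + r') ->
  r' <= expR ((2 * al + 4 * be) * t) * r.
Proof.
move=> al0 be0 t0 bt r0 hr.
apply: (@le_trans _ _ ((1 + (2 * al + 4 * be) * t) * r)); last first.
  by rewrite ler_wpM2r// expR_ge1Dx.
have bt1 : 0 < 1 - be * t by lra.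
rewrite -(ler_pM2l bt1).
have at0 : 0 <= al * t by rewrite mulr_ge0.
have bt0 : 0 <= be * t by rewrite mulr_ge0.
rewrite (mulrDl (2 * al)) -!mulrA.
set A := al * t in hr at0 *; set B := be * t in hr bt bt0 bt1 *.
apply: (@le_trans _ _ ((1 + A + B) * r)); first by lra.
rewrite mulrA ler_wpM2r//.
have : 0 <= (2^-1 - B) * (2 * A + 4 * B) by rewrite mulr_ge0//; lra.
lra.
Qed.

Lemma expR_gronwall (ga : R) (tau r : nat -> R) m :
  (forall k, (k < m)%N -> r k.+1 <= expR (ga * tau k) * r k) ->
  forall k, (k <= m)%N -> r k <= expR (ga * \sum_(j < k) tau j) * r 0%N.
Proof.
move=> step; elim=> [|k IH] km; first by rewrite big_ord0 mulr0 expR0 mul1r.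
rewrite (le_trans (step k km))// big_ord_recr /= mulrDr expRD.
rewrite (mulrC (expR (ga * \sum_(_ < _) _))) -mulrA.
by rewrite ler_wpM2l ?expR_ge0// IH// ltnW.
Qed.

End ErrorGrowth.

(** * Stability *)

Theorem theorem5p2 (R : realType)
  (a b : R) (a_gt0 : 0 < a) (b_gt0 : 0 < b)
  (Nx Ny : nat) (Nx_gt0 : (0 < Nx)%N) (Ny_gt0 : (0 < Ny)%N)
  (x y : nat -> R) (mesh_x : is_mesh Nx x) (mesh_y : is_mesh Ny y)
  (sigma : R -> R -> R)
  (sigma_ge0 : forall p, closure (@square R) p -> 0 <= sigma p.1 p.2)
  (sigma_eq0 : forall p, closure (@square R) p -> sigma p.1 p.2 = 0 ->
     (closure (@square R) `\` interior (@square R)) p)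
  (d : measure_display) (Omega : measurableType d) (P : probability Omega R)
  (eps : R -> R -> {RV P >-> R})
  (eps_bounded : exists K : R, forall p w, (@square R) p -> `|eps p.1 p.2 w| <= K)
  (f fu : R -> R -> R)
  (f_reaction : is_reaction_function
     [set e | exists p w, (@square R) p /\ e = eps p.1 p.2 w] f fu)
  (theta : R) (theta01 : 0 <= theta <= 1)
  (t0 Tq : R)
  (w : Omega) (kappa : R) (kappa_lt1 : kappa < 1) :
  exists2 taumax : R, 0 < taumax &
  forall t : R, exists2 C : R, 0 < C &
  forall (tau : nat -> R) (v v' : nat -> 'cV[R]_(Ny * Nx)) (m : nat),
    (forall j, 0 <= tau j) ->
    (forall j, (j <= m)%N -> tau j <= taumax) ->
    time_level t0 tau m.+1 <= Tq ->
    (forall k, (k <= m)%N ->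
       scheme_step a b x y sigma f (fun r s => eps r s w) theta (tau k)
         (v k) (v k.+1)) ->
    (forall k, (k <= m)%N ->
       scheme_step a b x y sigma f (fun r s => eps r s w) theta (tau k)
         (v' k) (v' k.+1)) ->
    reaction_args_in `[0, kappa]%classic theta v m ->
    reaction_args_in `[0, kappa]%classic theta v' m ->
    time_level t0 tau m = t ->
    before_quenching t0 tau v t ->
    forall k, (k <= m)%N ->
      norm2 (v k.+1 - v' k.+1) <= C * norm2 (v 0%N - v' 0%N).
Proof.
have [theta0 theta1] := andP theta01.
set n := (Ny * Nx)%N.
set g := @reaction R Nx Ny x y sigma f (fun r s => eps r s w).
set F := @Phi R a b Nx Ny x y sigma; set N := invmx (Mxy a b Nx Ny x y sigma).
have [c c0 F1] : near_id F by exact: near_id_Phi.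
have [L L0 gL] : exists2 L, 0 <= L & forall u u' : 'cV[R]_n,
    (forall p, u p 0 \in `[0, kappa]) -> (forall p, u' p 0 \in `[0, kappa]) ->
    `|g u - g u'| <= L * `|u - u'|.
  apply: (@reaction_lipschitz _ _ _ _ _ _ _ fu) => // p e.
  have [fV _] := f_reaction; have [] // := fV e.
  exists (x (mxtens_unindex p).2.+1, y (mxtens_unindex p).1.+1), w.
  by rewrite /e mxE; split=> //; split; apply: mesh_interior.
set al := n%:R * c; set be := n%:R * n%:R * `|N| * c * L.
have al0 : 0 <= al by rewrite mulr_ge0.
have be0 : 0 <= be by rewrite !mulr_ge0.
set ga := 2 * al + 4 * be.
(* this bound keeps both be * tau j <= 1/2 and tau j <= 1, as near_id needs *)
exists (1 + 2 * be)^-1 => [|t]; first by rewrite invr_gt0; lra.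
exists (Num.sqrt n%:R * expR (ga * (Tq - t0))) => [|tau v v' m].
  by rewrite mulr_gt0 ?expR_gt0// sqrtr_gt0 ltr0n muln_gt0 Ny_gt0.
move=> tau0 taumax tmTq sv sv' av av' _ _ k km.
pose z k := v k - v' k.
have zstep j : (j < m.+1)%N -> `|z j.+1| <= expR (ga * tau j) * `|z j|.
  rewrite ltnS => jm.
  have [tau1 btau] : tau j <= 1 /\ be * tau j <= 2^-1
    by exact: small_step (taumax j jm).
  have [av0 av1] := av j jm; have [av'0 av'1] := av' j jm.
  apply: implicit_growth => //.
  pose h := theta *: (g (v j) - g (v' j)) +
            (1 - theta) *: (g (v j.+1) - g (v' j.+1)).
  apply: (mxnorm_step (h := h) (F := F (tau j)) (N := N)) => //.
  - by apply: F1; rewrite tau0.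
  - apply: le_trans (ler_normD _ _) _; rewrite mulrDr !normrZ.
    apply: lerD.
      (* when a weight vanishes, the arguments of its reaction terms are
         unconstrained, but the terms drop out *)
      have [->|th] := eqVneq theta 0; first by rewrite normr0 mul0r mulr_ge0.
      rewrite ger0_norm// (le_trans (ler_piMl _ theta1))//.
      by apply: gL => p; [exact: av0|exact: av'0].
    have [->|th] := eqVneq theta 1.
      by rewrite subrr normr0 mul0r mulr_ge0.
    rewrite ger0_norm ?subr_ge0// (le_trans (ler_piMl _ _))//; first by lra.
    by apply: gL => p; [exact: av1|exact: av'1].
  - rewrite /z (sv j jm) (sv' j jm) -/F -/N -/g /h.
    rewrite !scalerBr addrACA -opprD !mulmxBr [RHS]addrACA -opprD.
    by congr (_ - _).
have := expR_gronwall zstep (k := k.+1) km => zk.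
apply: le_trans (norm2_le_mxnorm _) _; rewrite -mulrA ler_wpM2l ?sqrtr_ge0//.
apply: le_trans zk _; apply: ler_pM => //; rewrite ?expR_ge0 ?norm2_ge_mxnorm//.
rewrite ler_expR ler_wpM2l//; first by rewrite addr_ge0// mulr_ge0.
rewrite lerBrDl (le_trans _ tmTq)// /time_level lerD2l.
rewrite -(big_mkord xpredT tau) -[leRHS](big_mkord xpredT tau).
by rewrite [leRHS](@big_cat_nat _ _ _ k.+1)//= lerDl sumr_ge0.
Qed.
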